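(* Let $\mathbb K$ be a field of characteristic zero, let $d$ be a nonnegative integer, and consider the linear difference equation $$\sum_{m=0}^{d}p_m(n)\,y(n+m)=p(n),$$ where $p_0(n),p_1(n),\ldots,p_d(n),p(n)\in\mathbb K[n]$ are given polynomials such that $p_0(n)\ne 0$ and $p_d(n)\neq 0$. Let $$N=\mathrm{dis}(p_d(n-d),p_0(n))=\max\{k\in\mathbb N\mid \deg\gcd(p_d(n-d),p_0(n+k))\ge 1\},$$ with $N=-1$ if no such $k$ exists. Then $$G(n)=\gcd\bigl([p_0(n+N)]^{\underline{N+1}},\,[p_d(n-d)]^{\underline{N+1}}\bigr)$$ is a universal denominator for this difference equation, i.e. for every solution $y(n)\in\mathbb K(n)$ of the equation there exists $f(n)\in\mathbb K[n]$ such that $y(n)=f(n)/G(n)$.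
   Context: $\mathbb N$ is the set of nonnegative integers. The gcd of two polynomials in $\mathbb K[n]$ is normalized to be monic. For a polynomial $q(x)$ and an integer $k\ge 0$, the falling factorial of the polynomial is $[q(x)]^{\underline{k}}=q(x)q(x-1)\cdots q(x-k+1)$ (equal to $1$ for $k=0$). Thus $[p_0(n+N)]^{\underline{N+1}}=\prod_{j=0}^{N}p_0(n+j)$ and $[p_d(n-d)]^{\underline{N+1}}=\prod_{j=0}^{N}p_d(n-d-j)$; in particular $G(n)=1$ if $N=-1$. For $a(n),b(n)\in\mathbb K[n]$, the dispersion $\mathrm{dis}(a(n),b(n))$ is the greatest $k\in\mathbb N$ such that $\gcd(a(n),b(n+k))$ has positive degree, and $-1$ if no such $k$ exists. A polynomial $g(n)\in\mathbb K[n]$ is called a universal denominator for the equation if for every solution $y(n)\in\mathbb K(n)$ there exists $f(n)\in\mathbb K[n]$ with $y(n)=f(n)/g(n)$. *)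

(* Defs.v *)
From HB Require Import structures.
From mathcomp Require Import all_boot all_order all_algebra.
From mathcomp Require Import boolp classical_sets.
Set Implicit Arguments.
Unset Strict Implicit.
Unset Printing Implicit Defensive.
Import GRing.Theory.
Local Open Scope ring_scope.

Section Poly.
Variable K : fieldType.
Implicit Types (a b q : {poly K}).

(* q(n) |-> q(n + h) *)
Definition pshift (h : int) q : {poly K} := q \Po ('X + h%:~R%:P).

Definition falling_fact q (k : nat) : {poly K} :=
  \prod_(j < k) pshift (- j%:Z) q.

(* gcdp is only defined up to a nonzero constant factor *)
Definition monic_gcd a b : {poly K} := (lead_coef (gcdp a b))^-1 *: gcdp a b.

Lemma monic_gcd_monic a b :
  (a != 0) || (b != 0) -> monic_gcd a b \is monic.
Proof.
move=> nz; rewrite monicE lead_coefZ mulVf // lead_coef_eq0 gcdp_eq0.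
by rewrite negb_and.
Qed.

Definition common_factor_at a b (k : nat) : Prop :=
  (1 < size (monic_gcd a (pshift k%:Z b)))%N.

(* The default -1 is also returned when arbitrarily large k occur; by
   dispersionP this does not happen for nonzero polynomials in
   characteristic zero. *)
Definition dispersion a b : int :=
  xget (-1) [set N : int | exists2 k : nat, N = k%:Z &
    common_factor_at a b k /\
    forall j : nat, common_factor_at a b j -> (j <= k)%N].

(* So `|(dispersion a b + 1)%R|%N is dispersion a b + 1 as a natural number. *)
Lemma dispersion_geN1 a b : -1 <= dispersion a b.
Proof. by rewrite /dispersion; case: xgetP => [N _ [k -> _]|_]. Qed.

Lemma pshift_eq0 h q : (pshift h q == 0) = (q == 0).
Proof. by rewrite comp_poly_eq0 // size_XaddC. Qed.

Lemma pshiftM h q a : pshift h (q * a) = pshift h q * pshift h a.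
Proof. exact: rmorphM. Qed.

End Poly.

Lemma roots_nat_bounded (K : fieldType) (r : {poly K}) :
  [pchar K] =i pred0 -> r != 0 ->
  exists B : nat, forall k : nat, root r k%:R -> (k <= B)%N.
Proof.
move=> charK; move: {2}(size r) (leqnn (size r)) => n.
elim: n r => [|n IHn] r; first by rewrite leqn0 size_poly_eq0 => ->.
move=> szr nzr; have [[k rk]|nok] := pselect (exists k : nat, root r k%:R);
  last by exists 0%N => k rk; case: nok; exists k.
have [s Dr] := factor_theorem r k%:R rk.
have nzs : s != 0 by apply: contraNneq nzr => s0; rewrite Dr s0 mul0r.
have [] := IHn s _ nzs; first by move: szr; rewrite Dr size_Mmonic ?monicXsubC
  // size_XsubC addn2.
move=> B HB; exists (maxn B k) => j; rewrite Dr rootM root_XsubC.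
have natI : forall i l : nat, (i%:R == l%:R :> K) -> (i <= l)%N.
  move=> i l /eqP il; rewrite leqNgt; apply/negP => lti.
  have : (i - l)%:R = 0 :> K by rewrite natrB ?(ltnW lti) // il subrr.
  by move/eqP; rewrite (proj1 (pcharf0P K) charK) subn_eq0 leqNgt lti.
by case/orP => [/HB|/natI] le_j; rewrite leq_max le_j ?orbT.
Qed.

Lemma common_factor_bounded (K : fieldType) (a b : {poly K}) :
  [pchar K] =i pred0 -> a != 0 -> b != 0 ->
  exists B : nat, forall k : nat, common_factor_at a b k -> (k <= B)%N.
Proof.
move=> charK nza nzb.
have [B HB] := roots_nat_bounded charK (sub_annihilant_neq0 nzb nza).
exists B => k; rewrite /common_factor_at => szg; apply: HB.
set g := monic_gcd _ _ in szg.
have nzc : (lead_coef (gcdp a (pshift k b)))^-1 != 0.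
  by rewrite invr_eq0 lead_coef_eq0 gcdp_eq0 (negbTE nza).
have gE : g %= gcdp a (pshift k b) by apply: eqp_scale.
have ga : g %| a by rewrite (eqp_dvdl _ gE) dvdp_gcdl.
have gb : g %| pshift k b by rewrite (eqp_dvdl _ gE) dvdp_gcdr.
have sza : (1 < size a^:P)%N.
  by rewrite size_map_polyC (leq_trans szg) // dvdp_leq.
have szb : (1 < size b^:P)%N.
  rewrite size_map_polyC; have := dvdp_leq _ gb; rewrite pshift_eq0.
  move=> /(_ nzb) /(leq_trans szg); rewrite size_comp_poly2 //.
  by rewrite size_XaddC.
have [[u v] /= _ /(_ 'X (k%:R%:P))] := sub_annihilant_in_ideal szb sza.
have -> : sub_annihilant b^:P a^:P = (sub_annihilant b a)^:P.
  rewrite /sub_annihilant map_resultant ?map_polyC_eq0 ?lead_coef_eq0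
    ?poly_XaY_eq0 ?map_polyC_eq0 //.
  rewrite /poly_XaY map_comp_poly rmorphD /= map_polyC /= !map_polyX.
  rewrite -!map_poly_comp /= !(eq_map_poly (map_polyC _)).
  by rewrite !map_poly_comp.
have hE (r : {poly K}) x : r^:P.[x] = r \Po x by [].
rewrite !hE comp_polyXr.
have -> : b \Po ('X + k%:R%:P) = pshift k%:Z b by rewrite /pshift -pmulrn.
rewrite comp_polyCr => E.
have : g %| (sub_annihilant b a).[k%:R]%:P.
  by rewrite E; apply: dvdp_add; apply: dvdp_mull.
rewrite /root; case: eqP => // /eqP nz /dvdp_leq.
by rewrite polyC_eq0 nz size_polyC nz leqNgt szg => /(_ isT).
Qed.

Lemma dispersionP (K : fieldType) (a b : {poly K}) :
  [pchar K] =i pred0 -> a != 0 -> b != 0 ->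
  (exists2 k : nat, dispersion a b = k%:Z &
     common_factor_at a b k /\
     forall j : nat, common_factor_at a b j -> (j <= k)%N)
  \/ (dispersion a b = -1 /\ forall k : nat, ~ common_factor_at a b k).
Proof.
move=> charK nza nzb; rewrite /dispersion.
case: xgetP => [N _ [k -> Hk]|none]; first by left; exists k.
right; split=> // k ck.
have [B HB] := common_factor_bounded charK nza nzb.
have exP : exists k, `[< common_factor_at a b k >] by exists k; apply/asboolP.
have ubP j : `[< common_factor_at a b j >] -> (j <= B)%N by move/asboolP/HB.
case: (ex_maxnP exP ubP) => m /asboolP cm maxm.
by apply: (none m%:Z); exists m => //; split=> // j /asboolP/maxm.
Qed.

Notation "x %:F" := (tofrac x) : ring_scope.

Section Equation.
Variable K : fieldType.

(* y(n) |-> y(n + h) on K(n); by ratshift_frac the choice of the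
   representative is immaterial. *)
Definition ratshift (h : int) (y : {fraction {poly K}}) : {fraction {poly K}} :=
  (pshift h \n_(repr y))%:F / (pshift h \d_(repr y))%:F.

Lemma ratshift_frac (h : int) (a b : {poly K}) :
  b != 0 -> ratshift h (a%:F / b%:F) = (pshift h a)%:F / (pshift h b)%:F.
Proof.
move=> nzb; rewrite /ratshift.
set y := a%:F / b%:F; set c := \n_(repr y); set e := \d_(repr y).
have nze : e != 0 by apply: denom_ratioP.
have yE : y = c%:F / e%:F.
  rewrite -[LHS]reprK -[repr y]Ratio_numden -/c -/e; unlock tofrac.
  rewrite -[X in _ = _ * X]FracField.pi_inv -[RHS]FracField.pi_mul.
  rewrite /FracField.mulf /FracField.invf.
  by rewrite !numden_Ratio ?oner_neq0 // mulr1 mul1r.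
have nzs q : q != 0 -> (pshift h q)%:F != 0 by rewrite tofrac_eq0 pshift_eq0.
have /eqP : c%:F / e%:F = a%:F / b%:F by rewrite -yE.
rewrite eqr_div ?tofrac_eq0 // -!tofracM tofrac_eq => /eqP ce.
by apply/eqP; rewrite eqr_div ?nzs // -!tofracM tofrac_eq -!pshiftM ce.
Qed.

Definition is_solution (d : nat) (p : 'I_d.+1 -> {poly K}) (q : {poly K})
    (y : {fraction {poly K}}) : Prop :=
  \sum_(m < d.+1) (p m)%:F * ratshift m%:Z y = q%:F.

(* g != 0 is required since f%:F / 0 would be 0. *)
Definition universal_denominator (d : nat) (p : 'I_d.+1 -> {poly K})
    (q g : {poly K}) : Prop :=
  g != 0 /\
  forall y : {fraction {poly K}}, is_solution p q y ->
    exists f : {poly K}, y = f%:F / g%:F.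

End Equation.

(* Main.v *)
(** Write a solution in lowest terms as [y = f / g].  Using the equation to
    eliminate [y(n), y(n+1), ...] successively, [p_0(n) ... p_0(n+k-1) y(n)] is
    a K[n]-linear combination of [1] and of the [y(n+i)] with [i >= k].  Hence a
    divisor [w] of [g] that is coprime to all [g(n+i)], [i >= k], divides
    [p_0(n) ... p_0(n+k-1)].  Running the equation backwards gives the same with
    [p_d(n-d)] and step [-1].

    Let [h = dis(g, g)] and [u = gcd(g(n), g(n+h))].  By maximality of [h], the
    case [k = 1] applies to [u] backwards and to [u(n-h)] forwards, so [u]
    divides both [p_d(n-d)] and [p_0(n+h)]; thus [h <= N].  The case
    [w = g], [k = N + 1] then shows that [g] divides both falling factorials. *)

From HB Require Import structures.
Require Import Defs.
From mathcomp Require Import all_boot all_order all_algebra ring zify.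
Set Implicit Arguments.
Unset Strict Implicit.
Unset Printing Implicit Defensive.
Import GRing.Theory.
Local Open Scope ring_scope.

(** * Shifts and gcds of polynomials *)

Section Shift.
Variable K : fieldType.
Implicit Types (a b c f g w r : {poly K}) (y z : {fraction {poly K}}).

HB.instance Definition _ h :=
  GRing.RMorphism.copy (@pshift K h) (comp_poly ('X + h%:~R%:P)).

Lemma pshift_pshift h k a : pshift h (pshift k a) = pshift (h + k) a.
Proof.
rewrite /pshift -comp_polyA comp_polyD comp_polyX comp_polyC.
by rewrite -addrA -polyCD -intrD.
Qed.

Lemma pshift0 a : pshift 0 a = a.
Proof. by rewrite /pshift addr0 comp_polyXr. Qed.

Lemma pshiftK h : cancel (@pshift K h) (pshift (- h)).
Proof. by move=> a; rewrite pshift_pshift addNr pshift0. Qed.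

Lemma pshift_dvd h a b : (pshift h a %| pshift h b) = (a %| b).
Proof.
apply/idP/idP; last exact: dvdp_comp_poly.
move=> /(dvdp_comp_poly ('X + (- h)%:~R%:P)).
by rewrite -!/(pshift _ _) !pshiftK.
Qed.

Lemma pshift_coprime h a b : coprimep (pshift h a) (pshift h b) = coprimep a b.
Proof.
apply/idP/idP; last exact: coprimep_comp_poly.
move=> /(coprimep_comp_poly ('X + (- h)%:~R%:P)).
by rewrite -!/(pshift _ _) !pshiftK.
Qed.

(** As [a] is nonzero, so is the gcd; this excludes size 0, where the pair would be neither coprime
    nor counted as having a common factor. *)
Lemma common_factor_atE a b k :
  a != 0 -> common_factor_at a b k <-> ~~ coprimep a (pshift k%:Z b).
Proof.
move=> nza; have nzg : gcdp a (pshift k b) != 0.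
  by rewrite gcdp_eq0 (negbTE nza).
rewrite /common_factor_at /monic_gcd size_scale ?invr_eq0 ?lead_coef_eq0 //.
rewrite /coprimep; have := nzg; rewrite -size_poly_gt0.
by case: (size _) => [|[|n]].
Qed.

Lemma monic_gcd_dvd w a b : w %| a -> w %| b -> w %| monic_gcd a b.
Proof.
move=> wa wb; have [g0|nzg] := eqVneq (gcdp a b) 0.
  by rewrite /monic_gcd g0 scaler0 dvdp0.
by rewrite dvdpZr ?invr_eq0 ?lead_coef_eq0 // dvdp_gcd wa.
Qed.

Lemma falling_fact_neq0 a k : a != 0 -> falling_fact a k != 0.
Proof.
by move=> nza; apply/prodf_neq0 => j _; rewrite pshift_eq0.
Qed.

(** Reversing the order of the factors gives the ascending product that forward elimination
    produces. *)
Lemma falling_fact_rev a k :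
  falling_fact (pshift k%:Z a) k.+1 = \prod_(j < k.+1) pshift j%:Z a.
Proof.
rewrite /falling_fact (reindex_inj rev_ord_inj); apply: eq_bigr => j _.
rewrite pshift_pshift; congr pshift => /=.
by have := ltn_ord j; lia.
Qed.

(** * Reduced fractions and shifts of rational functions *)

Lemma frac_numden y : exists a b, [/\ b != 0, coprimep a b & y = a%:F / b%:F].
Proof.
pose c := \n_(repr y); pose e := \d_(repr y).
have nze : e != 0 by apply: denom_ratioP.
have yE : y = c%:F / e%:F.
  rewrite -[LHS]reprK -[repr y]Ratio_numden -/c -/e; unlock tofrac.
  rewrite -[X in _ = _ * X]FracField.pi_inv -[RHS]FracField.pi_mul.
  rewrite /FracField.mulf /FracField.invf.
  by rewrite !numden_Ratio ?oner_neq0 // mulr1 mul1r.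
have nzg : gcdp c e != 0 by rewrite gcdp_eq0 (negbTE nze) andbF.
have cE := divpK (dvdp_gcdl c e); have eE := divpK (dvdp_gcdr c e).
have nzb : e %/ gcdp c e != 0.
  by apply: contraNneq nze => e0; rewrite -eE e0 mul0r.
exists (c %/ gcdp c e), (e %/ gcdp c e); split=> //.
  by apply: coprimep_div_gcd; rewrite nze orbT.
rewrite yE -[in c%:F]cE -[in e%:F]eE !tofracM -mulf_div divff ?mulr1 //.
by rewrite tofrac_eq0.
Qed.

Lemma ratshift_poly h a : ratshift h a%:F = (pshift h a)%:F.
Proof.
by rewrite -[a%:F]divr1 -tofrac1 ratshift_frac ?oner_neq0 // rmorph1 divr1.
Qed.

Lemma ratshift_is_zmod_morphism h : zmod_morphism (@ratshift K h).
Proof.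
move=> y z; have [a [b [nzb _ ->]]] := frac_numden y.
have [c [e [nze _ ->]]] := frac_numden z.
have nzF r : r != 0 -> r%:F != 0 by rewrite tofrac_eq0.
have nzsF r : r != 0 -> (pshift h r)%:F != 0 by rewrite tofrac_eq0 pshift_eq0.
rewrite -mulNr addf_div ?nzF // -tofracN -!tofracM -tofracD.
rewrite !ratshift_frac ?mulf_neq0 // -mulNr addf_div ?nzsF //.
by rewrite -tofracN -!tofracM -tofracD !(rmorphD, rmorphM, rmorphN).
Qed.

HB.instance Definition _ h :=
  GRing.isZmodMorphism.Build _ _ (@ratshift K h) (ratshift_is_zmod_morphism h).

Lemma ratshift_is_monoid_morphism h : monoid_morphism (@ratshift K h).
Proof.
split; first by rewrite -tofrac1 ratshift_poly rmorph1.
move=> y z; have [a [b [nzb _ ->]]] := frac_numden y.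
have [c [e [nze _ ->]]] := frac_numden z.
rewrite mulf_div -!tofracM !ratshift_frac ?mulf_neq0 //.
by rewrite mulf_div -!tofracM !rmorphM.
Qed.

HB.instance Definition _ h :=
  GRing.isMonoidMorphism.Build _ _ (@ratshift K h)
    (ratshift_is_monoid_morphism h).

Lemma ratshift_ratshift h k y : ratshift h (ratshift k y) = ratshift (h + k) y.
Proof.
have [a [b [nzb _ ->]]] := frac_numden y.
by rewrite !ratshift_frac ?pshift_eq0 // !pshift_pshift.
Qed.

Lemma ratshift0 y : ratshift 0 y = y.
Proof.
have [a [b [nzb _ ->]]] := frac_numden y.
by rewrite ratshift_frac // !pshift0.
Qed.

(** * Successive elimination of the shifts of a solution *)

(* The K[n]-submodule of K(n) spanned by 1 and the y(n + s i), i >= k. *)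
Inductive shift_span (s : int) y (k : nat) : {fraction {poly K}} -> Prop :=
| shift_span_poly a : shift_span s y k a%:F
| shift_span_shift a i : (k <= i)%N ->
    shift_span s y k (a%:F * ratshift (s * i%:Z) y)
| shift_span_add z z' :
    shift_span s y k z -> shift_span s y k z' -> shift_span s y k (z + z').

Lemma shift_spanMl s y k a z :
  shift_span s y k z -> shift_span s y k (a%:F * z).
Proof.
elim=> [b|b i ki|z1 z2 _ IH1 _ IH2].
- by rewrite -tofracM; apply: shift_span_poly.
- by rewrite mulrA -tofracM; apply: shift_span_shift.
- by rewrite mulrDr; apply: shift_span_add.
Qed.

Lemma shift_span_sum s y k n (F : 'I_n -> {fraction {poly K}}) :
  (forall i, shift_span s y k (F i)) -> shift_span s y k (\sum_i F i).
Proof.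
move=> FP; apply: big_ind => //; last exact: shift_span_add.
by rewrite -tofrac0; apply: shift_span_poly.
Qed.

Section Step.
(** The step [s] is left free so that one argument covers both directions: it is applied with
    [s = 1] to the given equation and with [s = -1] to the reversed one. *)
Variables (s : int) (d : nat) (c : 'I_d.+1 -> {poly K}) (q : {poly K}).
Variable y : {fraction {poly K}}.
Hypothesis eq_y : \sum_(m < d.+1) (c m)%:F * ratshift (s * m%:Z) y = q%:F.

Lemma shift_span_step k z : shift_span s y k z ->
  shift_span s y k.+1 ((pshift (s * k%:Z) (c ord0))%:F * z).
Proof.
elim=> [b|b i|z1 z2 _ IH1 _ IH2]; last 1 first.
- by rewrite mulrDr; apply: shift_span_add.
- by rewrite -tofracM; apply: shift_span_poly.
rewrite leq_eqVlt => /predU1P[<-{i}|ki]; last first.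
  by apply: shift_spanMl; apply: shift_span_shift.
rewrite mulrCA; apply: shift_spanMl.
(* Only the generator of index [k] has to be eliminated. The equation shifted by [s * k] is solved
   for its term [m = 0]; the remaining shifts have index at least [k + 1]. *)
have /(congr1 (ratshift (s * k%:Z))) := eq_y.
rewrite big_ord_recl raddfD /= (rmorphM (ratshift _)) /= !ratshift_poly.
rewrite ratshift_ratshift mulr0 addr0 => /(canRL (addrK _)) ->.
apply: shift_span_add; first exact: shift_span_poly.
rewrite raddf_sum -sumrN; apply: shift_span_sum => m.
rewrite /= rmorphM /= ratshift_poly ratshift_ratshift -mulrDr -mulNr -tofracN.
rewrite -PoszD; apply: shift_span_shift => /=.
by rewrite /bump; lia.
Qed.

Lemma shift_span_prod k : shift_span s y k
  ((\prod_(j < k) pshift (s * j%:Z) (c ord0))%:F * y).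
Proof.
elim: k => [|k IHk].
  have := shift_span_shift s y 1 (leqnn 0).
  by rewrite big_ord0 mulr0 ratshift0.
rewrite big_ord_recr /= [X in X%:F]mulrC tofracM -mulrA.
exact: shift_span_step.
Qed.

(** Every generator has denominator 1 or a shift of [g] coprime to [w], and products of denominators
    coprime to [w] stay coprime to [w]. *)
Lemma shift_span_denom f g w k z : g != 0 -> y = f%:F / g%:F ->
  (forall i, (k <= i)%N -> coprimep w (pshift (s * i%:Z) g)) ->
  shift_span s y k z ->
  exists2 b, coprimep w b & exists a, b%:F * z = a%:F.
Proof.
move=> nzg -> cop.
elim=> [a|a i ki|z1 z2 _ [b1 cb1 [a1 E1]] _ [b2 cb2 [a2 E2]]].
- by exists 1; rewrite ?coprimep1 //; exists a; rewrite tofrac1 mul1r.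
- exists (pshift (s * i%:Z) g); first exact: cop.
  exists (a * pshift (s * i%:Z) f); rewrite ratshift_frac // tofracM.
  by rewrite mulrCA [_ * (_ / _)]mulrC divfK // tofrac_eq0 pshift_eq0.
- exists (b1 * b2); first by rewrite coprimepMr cb1.
  exists (b2 * a1 + b1 * a2).
  by rewrite tofracD !tofracM -E1 -E2; ring.
Qed.

Lemma denominator_factor_dvd f g w k :
  g != 0 -> coprimep f g -> y = f%:F / g%:F -> w %| g ->
  (forall i, (k <= i)%N -> coprimep w (pshift (s * i%:Z) g)) ->
  w %| \prod_(j < k) pshift (s * j%:Z) (c ord0).
Proof.
move=> nzg cfg yE wg cop.
have [b cwb [a E]] := shift_span_denom nzg yE cop (shift_span_prod k).
set A := \prod_(j < k) _ in E *.
have {}E : b * A * f = a * g.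
  apply/eqP; rewrite -tofrac_eq !tofracM -E yE.
  by rewrite !mulrA divfK // tofrac_eq0.
(* Now [w] divides [a * g = b * A * f] and is coprime to both [b] and [f], so Gauss's lemma leaves
   [A]. *)
have cwf : coprimep w f by apply: (coprimep_dvdr wg); rewrite coprimep_sym.
rewrite -(Gauss_dvdpr _ cwb) -(Gauss_dvdpl _ cwf) E.
exact: dvdp_mull.
Qed.

End Step.

(** * Bounding the dispersion of the denominator *)

Lemma common_shifted_factor a b g h :
  g != 0 -> a != 0 -> gcdp g (pshift h%:Z g) %| a ->
  gcdp g (pshift h%:Z g) %| pshift h%:Z b ->
  common_factor_at g g h -> common_factor_at a b h.
Proof.
move=> nzg nza ua ub; rewrite !common_factor_atE //; apply: contra => cab.
(* Otherwise the gcd of [g] and its shift would be coprime to itself, hence constant. *)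
have := coprimep_dvdr ua (coprimep_dvdl ub cab).
by rewrite coprimepp.
Qed.

(** Shifting the equation by [-d] and reversing the summation makes p_d(n-d) the coefficient of
    y(n). *)
Lemma is_solution_reverse d (p : 'I_d.+1 -> {poly K}) q y :
  is_solution p q y ->
  \sum_(m < d.+1) (pshift (- d%:Z) (p (rev_ord m)))%:F
    * ratshift (-1 * m%:Z) y = (pshift (- d%:Z) q)%:F.
Proof.
move=> /(congr1 (ratshift (- d%:Z))); rewrite ratshift_poly => <-.
rewrite raddf_sum (reindex_inj rev_ord_inj); apply: eq_bigr => m _.
rewrite rev_ordK /= rmorphM /= ratshift_poly ratshift_ratshift.
congr (_ * ratshift _ y) => /=; have := ltn_ord m; lia.
Qed.

Lemma solution_dispersion_le d (p : 'I_d.+1 -> {poly K}) q f g k :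
  [pchar K] =i pred0 -> p ord0 != 0 -> p ord_max != 0 ->
  g != 0 -> coprimep f g -> is_solution p q (f%:F / g%:F) ->
  common_factor_at g g k ->
  exists2 n : nat, (k <= n)%N &
    dispersion (pshift (- d%:Z) (p ord_max)) (p ord0) = n%:Z.
Proof.
move=> charK nzp0 nzpd nzg cfg sol ck.
have nza : pshift (- d%:Z) (p ord_max) != 0 by rewrite pshift_eq0.
(* Passing from [k] to the largest index [h] makes g(n) coprime to g(n+h+i) for all i >= 1. *)
have [[h _ [ch maxh]]|[_ none]] := dispersionP charK nzg nzg; last first.
  by case: (none k).
have le_kh := maxh _ ck.
have cop i : (1 <= i)%N -> coprimep g (pshift (h%:Z + i%:Z) g).
  move=> i0; apply/negPn/negP; rewrite -PoszD -common_factor_atE // => /maxh.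
  lia.
set u := gcdp g (pshift h%:Z g).
have ug : u %| g by apply: dvdp_gcdl.
have uh : u %| pshift h%:Z g by apply: dvdp_gcdr.
have ch' : common_factor_at (pshift (- d%:Z) (p ord_max)) (p ord0) h.
  apply: common_shifted_factor ch => //; rewrite -/u.
  - have cB i : (1 <= i)%N -> coprimep u (pshift (-1 * i%:Z) g).
      (* Shifting by [i] turns the pair g(n+h), g(n-i) into g(n+h+i), g(n). *)
      move=> i1; apply: (coprimep_dvdr uh); rewrite -(pshift_coprime i%:Z).
      by rewrite !pshift_pshift coprimep_sym mulN1r subrr pshift0 addrC cop.
    have := denominator_factor_dvd (is_solution_reverse sol) nzg cfg erefl
      ug cB.
    rewrite big_ord1 mulr0 pshift0; congr (_ %| pshift _ (p _)).
    by apply: val_inj; rewrite /= subn1.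
  - rewrite -(pshift_dvd (- h%:Z)) pshiftK.
    have wg : pshift (- h%:Z) u %| g.
      by rewrite -(pshift_dvd h%:Z) pshift_pshift subrr pshift0.
    have cF i : (1 <= i)%N ->
        coprimep (pshift (- h%:Z) u) (pshift (1 * i%:Z) g).
      move=> i1; rewrite -(pshift_coprime h%:Z) !pshift_pshift subrr pshift0.
      by rewrite mul1r; apply: (coprimep_dvdr ug); apply: cop.
    have eq_y : \sum_(m < d.+1)
        (p m)%:F * ratshift (1 * m%:Z) (f%:F / g%:F) = q%:F.
      by under eq_bigr do rewrite mul1r.
    have := denominator_factor_dvd eq_y nzg cfg erefl wg cF.
    by rewrite big_ord1 mulr0 pshift0.
have [[n -> [_ maxn]]|[_ none]] := dispersionP charK nza nzp0.
  by exists n => //; apply: leq_trans le_kh (maxn _ ch').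
by case: (none h).
Qed.

End Shift.

Theorem theorem4p2 (K : fieldType) (charK : [pchar K] =i pred0)
    (d : nat) (p : 'I_d.+1 -> {poly K}) (q : {poly K})
    (p0_neq0 : p ord0 != 0) (pd_neq0 : p ord_max != 0) :
  let N : int := dispersion (pshift (- d%:Z) (p ord_max)) (p ord0) in
  let G : {poly K} :=
    monic_gcd (falling_fact (pshift N (p ord0)) `|(N + 1)%R|%N)
              (falling_fact (pshift (- d%:Z) (p ord_max)) `|(N + 1)%R|%N) in
  universal_denominator p q G.
Proof.
move=> N; set k := `|(N + 1)%R|%N; move=> G.
have nzG : G != 0.
  by rewrite monic_neq0 ?monic_gcd_monic // falling_fact_neq0 ?pshift_eq0.
split=> // y sol; have [f [g [nzg cfg yE]]] := frac_numden y.
rewrite yE in sol *.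
(* Since [k] is [N + 1], a common factor at such an [i] would force [i <= N]. *)
have cop i : (k <= i)%N -> coprimep g (pshift i%:Z g).
  move=> ki; apply/negPn/negP; rewrite -common_factor_atE //.
  move=> /(solution_dispersion_le charK p0_neq0 pd_neq0 nzg cfg sol)[n le_in].
  by rewrite -/N => NE; move: ki; rewrite /k NE; lia.
have copN i : (k <= i)%N -> coprimep g (pshift (-1 * i%:Z) g).
  move=> ki; rewrite -(pshift_coprime i%:Z) pshift_pshift mulN1r subrr pshift0.
  by rewrite coprimep_sym cop.
have gG : g %| G.
  apply: monic_gcd_dvd.
    have -> : falling_fact (pshift N (p ord0)) k =
              \prod_(j < k) pshift (1 * j%:Z) (p ord0).
      have := dispersion_geN1 (pshift (- d%:Z) (p ord_max)) (p ord0).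
      (* For [N = -1] both products are empty; smaller values are excluded by [dispersion_geN1]. *)
      rewrite -/N /k; case: (N) => [n|[|n]] // _; last first.
        by rewrite /falling_fact !big_ord0.
      rewrite -PoszD addn1 falling_fact_rev.
      by under [RHS]eq_bigr do rewrite mul1r.
    apply: (denominator_factor_dvd (f := f) _ nzg cfg erefl (dvdpp g)).
      by under eq_bigr do rewrite mul1r; exact: sol.
    by move=> i ki; rewrite mul1r cop.
  have := denominator_factor_dvd (is_solution_reverse sol) nzg cfg erefl
    (dvdpp g) copN.
  rewrite (_ : rev_ord ord0 = ord_max); last first.
    by apply: val_inj; rewrite /= subn1.
  by under eq_bigr do rewrite mulN1r.
have nzQ : G %/ g != 0.
  by apply: contraNneq nzG => Q0; rewrite -(divpK gG) Q0 mul0r.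
(* Expanding f/g by the cofactor of [g] in [G] gives the denominator [G]. *)
exists (f * (G %/ g)).
rewrite -[X in _ = _ / X%:F](divpK gG) [(G %/ g) * g]mulrC !tofracM.
by rewrite -mulf_div divff ?tofrac_eq0 ?mulr1.
Qed.
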